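(* Let $k$ be a field, let $n\in\mathbb{N}\setminus\{0\}$, and regard $\mathbb{Z}^n$ as an ordered abelian group with respect to the lexicographic ordering. Then the following hold. (i) $k(\mathbb{Z}^n)=k(\underline{x})\subseteq k((\underline{x}))\subseteq k((\mathbb{Z}^n))$; hence both $k(\underline{x})$ and $k((\underline{x}))$ are Hahn fields with coefficient field $k$ and value group $\mathbb{Z}^n$. (ii) $k((\underline{x}))=\langle S(\mathcal{P}(\mathbb{N}^n))\rangle=\langle S(\{\mathbb{N}^n\})\rangle$; in particular $k((\underline{x}))$ is determined by linear recurrence relations. (iii) $k((\underline{x}))$ is not the minimal Hahn field, i.e. $k((\underline{x}))\neq k(\underline{x})$. (iv) If $n=1$, then $k((x_1))=k((\mathbb{Z}))$. If $n\geq 2$, then $k((\underline{x}))\neq k((\mathbb{Z}^n))$; indeed, the power series $\sum_{i=0}^\infty t^{(i^2,-i,0,\ldots,0)}\in k((\mathbb{Z}^n))$ does not lie in $k((\underline{x}))$.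
   Context: $\mathbb{N}$ includes $0$. For an ordered abelian group $G$, $k((G))$ denotes the field of generalised power series: all functions $s\colon G\to k$, written $s=\sum_{g\in G}s_gt^g$, whose support $\mathrm{supp}(s)=\{g\in G\mid s_g\neq 0\}$ is a well-ordered subset of $G$, with pointwise addition and product $sp=\sum_{g}\left(\sum_{h}s_hp_{g-h}\right)t^g$. $k[G]$ is the subring of all $s$ with finite support, and $k(G)$ is its fraction field inside $k((G))$. A Hahn field (with coefficient field $k$ and value group $G$) is a field $K$ with $k(G)\subseteq K\subseteq k((G))$; $k(G)$ is the minimal and $k((G))$ the maximal Hahn field. Write $\underline{x}=(x_1,\ldots,x_n)$. $k(\underline{x})$ is the fraction field of the polynomial ring $k[\underline{x}]$ and $k((\underline{x}))$ is the fraction field of the formal power series ring $k[[\underline{x}]]$. Since $\mathbb{N}^n$ is well-ordered in the lexicographic ordering of $\mathbb{Z}^n$, the map $\sum_{g\in\mathbb{N}^n}s_g\underline{x}^g\mapsto\sum_{g\in\mathbb{N}^n}s_gt^g$ is an isomorphism of $k[[\underline{x}]]$ onto $\{s\in k((\mathbb{Z}^n))\mid\mathrm{supp}(s)\subseteq\mathbb{N}^n\}$; via it $k[[\underline{x}]]$ and its fraction field $k((\underline{x}))$ are regarded as subsets of $k((\mathbb{Z}^n))$. A linear recurrence sequence is a partial function $r\colon G\rightharpoonup k$ with well-ordered domain $\mathrm{dom}(r)\subseteq G$; it is non-trivial if $r(g)\neq 0$ for some $g\in\mathrm{dom}(r)$. $\mathrm{LRS}(k,G)$ is the set of all of them. $\langle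 r\rangle$ is the set of all $s\in k((G))$ such that $\sum_{g\in\mathrm{dom}(r)}r(g)s_{h-g}=0$ for every $h\in G\setminus\mathrm{dom}(r)$ (a sum with finitely many non-zero terms), and $\langle R\rangle=\bigcup_{r\in R}\langle r\rangle$ for $R\subseteq\mathrm{LRS}(k,G)$. A set $S\subseteq k((G))$ is determined by linear recurrence relations if $S=\langle R\rangle$ for some $R\subseteq\mathrm{LRS}(k,G)$. For a family $\mathcal{F}$ of well-ordered subsets of $G$, $S(\mathcal{F})$ is the set of all non-trivial $r\in\mathrm{LRS}(k,G)$ with $\mathrm{dom}(r)\in\mathcal{F}$. $\mathcal{P}(\mathbb{N}^n)$ is the power set of $\mathbb{N}^n$. *)

(* Defs.v *)
From HB Require Import structures.
From mathcomp Require Import all_boot all_order all_algebra.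
From mathcomp Require Import boolp classical_sets functions cardinality fsbigop.
From mathcomp Require wochoice mpoly.

Set Implicit Arguments.
Unset Strict Implicit.
Unset Printing Implicit Defensive.

Import Order.TTheory GRing.Theory Num.Theory.
Local Open Scope classical_set_scope.
Local Open Scope ring_scope.

HB.mixin Record POrderedZmodule_isOrderedGroup G of Num.POrderedZmodule G := {
  ogroup_le_total : forall x y : G, (x <= y) || (y <= x);
  ogroup_leD2l : forall z x y : G, x <= y -> z + x <= z + y
}.

#[short(type="orderedGroupType")]
HB.structure Definition OrderedGroup :=
  { G of Num.POrderedZmodule G & POrderedZmodule_isOrderedGroup G }.

Section OrderedGroupTheory.
Variable G : orderedGroupType.
Implicit Types x y z : G.

Lemma og_comparable x y : x >=< y.
Proof. exact: ogroup_le_total. Qed.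

Lemma og_ltNge x y : (x < y) = ~~ (y <= x).
Proof. exact: comparable_ltNge (og_comparable x y). Qed.

Lemma og_leNgt x y : (x <= y) = ~~ (y < x).
Proof. exact: comparable_leNgt (og_comparable x y). Qed.

Definition og_leP x y := comparable_leP (og_comparable x y).
Definition og_ltP x y := comparable_ltP (og_comparable x y).

Lemma og_leD2l z x y : (z + x <= z + y) = (x <= y).
Proof.
apply/idP/idP => [/(ogroup_leD2l (- z))|]; last exact: ogroup_leD2l.
by rewrite !addKr.
Qed.

Lemma og_ltD2l z x y : (z + x < z + y) = (x < y).
Proof. by rewrite !og_ltNge og_leD2l. Qed.

Lemma og_leD2r z x y : (x + z <= y + z) = (x <= y).
Proof. by rewrite ![_ + z]addrC og_leD2l. Qed.

Lemma og_ltD2r z x y : (x + z < y + z) = (x < y).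
Proof. by rewrite !og_ltNge og_leD2r. Qed.

Lemma og_leBlD x y z : (x - y <= z) = (x <= z + y).
Proof. by rewrite -[LHS](og_leD2r y) subrK. Qed.

Lemma og_leBrD x y z : (z <= x - y) = (z + y <= x).
Proof. by rewrite -[LHS](og_leD2r y) subrK. Qed.

Lemma og_ltBrD x y z : (z < x - y) = (z + y < x).
Proof. by rewrite -[LHS](og_ltD2r y) subrK. Qed.

End OrderedGroupTheory.

Definition well_ordered (G : orderedGroupType) (A : set G) : Prop :=
  wochoice.wo_chain <=%R [in A].

Section WellOrdered.
Variable G : orderedGroupType.
Implicit Types A B C : set G.

Lemma well_orderedP A : well_ordered A <->
  forall B, B `<=` A -> B !=set0 ->
    exists2 x, B x & forall y, B y -> x <= y.
Proof.
split=> [Awo B sBA [x Bx]|Awo B sBA [x Bx]].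
  have sB : sub_mem (mem [in B]) (mem [in A]).
    by move=> y; rewrite !inE => /sBA.
  have xB : x \in [in B] by rewrite !inE.
  have [z [[zB zlb] _]] := Awo [in B] sB (ex_intro _ x xB).
  exists z; first by rewrite !inE in zB.
  by move=> y By; apply: zlb; rewrite !inE.
have [||z zB zlb] := Awo [set y | y \in B].
- by move=> y /= /sBA; rewrite inE.
- by exists x.
exists z; split; first by split.
move=> y [yB ylb]; apply/eqP; rewrite eq_le.
by rewrite (ylb _ zB) (zlb _ yB).
Qed.

Lemma sub_well_ordered A B : A `<=` B -> well_ordered B -> well_ordered A.
Proof.
move=> sAB /well_orderedP Bwo; apply/well_orderedP => C sCA.
by apply: Bwo; apply: subset_trans sAB.
Qed.

Arguments sub_well_ordered : clear implicits.
Arguments sub_well_ordered {A B}.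

Lemma well_ordered0 : @well_ordered G set0.
Proof. by apply/well_orderedP => B sB [x /sB]. Qed.

Lemma well_ordered1 x : @well_ordered G [set x].
Proof.
apply/well_orderedP => B sB [y By]; exists y => // z /sB ->.
by rewrite (sB _ By).
Qed.

Arguments well_ordered0 : clear implicits.
Arguments well_ordered1 : clear implicits.

Lemma well_orderedU A B : well_ordered A -> well_ordered B ->
  well_ordered (A `|` B).
Proof.
move=> /well_orderedP Awo /well_orderedP Bwo; apply/well_orderedP => C sC C0.
have [CA|CA] := pselect ((C `&` A) !=set0); last first.
  apply: Bwo => // x Cx; have [Ax|//] := sC _ Cx.
  by case: CA; exists x.
have [CB|CB] := pselect ((C `&` B) !=set0); last first.
  apply: Awo => // x Cx; have [//|Bx] := sC _ Cx.
  by case: CB; exists x.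
have [a [Ca Aa] amin] := Awo _ (@subIsetr _ C A) CA.
have [b [Cb Bb] bmin] := Bwo _ (@subIsetr _ C B) CB.
have [ab|/ltW ba] := og_leP a b.
  exists a => // c Cc; have [Ac|Bc] := sC _ Cc; first exact: amin.
  by apply: (le_trans ab); apply: bmin.
exists b => // c Cc; have [Ac|Bc] := sC _ Cc; last exact: bmin.
by apply: (le_trans ba); apply: amin.
Qed.

Arguments well_orderedU : clear implicits.
Arguments well_orderedU {A B}.

Lemma well_ordered_fin A : finite_set A -> well_ordered A.
Proof.
move=> /finite_setP[n]; elim: n A => [|n IHn] A.
  by rewrite II0 card_eq0 => /eqP->; exact: well_ordered0.
move=> /eq_cardSP[x Ax /IHn Awo].
rewrite -(setD1K Ax); apply: well_orderedU => //; exact: well_ordered1.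
Qed.

Lemma wo_fiber_finite A B g : well_ordered A -> well_ordered B ->
  finite_set [set h | A h /\ B (g - h)].
Proof.
move=> /well_orderedP Awo /well_orderedP Bwo.
set X := [set h | _].
have sXA : X `<=` A by move=> h [].
have Xmax (Y : set G) : Y `<=` X -> Y !=set0 ->
    exists2 x, Y x & forall y, Y y -> y <= x.
  move=> sYX [y0 Yy0].
  have [||b /= Yb bmin] := Bwo [set b | Y (g - b)].
  - by move=> b /= /sYX [_]; rewrite subKr.
  - by exists (g - y0); rewrite /= subKr.
  exists (g - b) => // y Yy.
  have /bmin : [set b | Y (g - b)] (g - y) by rewrite /= subKr.
  by rewrite !og_leBrD addrC.
have [XE|Xn] := pselect (forall x, X x -> finite_set [set y | X y /\ y <= x]).
  have [->|X0] := eqVneq X set0; first exact: finite_set0.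
  move/set0P in X0.
  have [x Xx xmax] := Xmax X (@subset_refl _ _) X0.
  by apply: sub_finite_set (XE _ Xx) => y Xy; split => //; apply: xmax.
have [||x [Xx xinf] xmin] :=
    Awo [set x | X x /\ ~ finite_set [set y | X y /\ y <= x]].
- by move=> x [/sXA].
- by move: Xn => /existsNP[x /not_implyP[Xx xinf]]; exists x.
case: xinf.
have [Y0|Y0] := pselect ([set y | X y /\ y < x] !=set0); last first.
  apply: sub_finite_set (finite_set1 x) => y [Xy]; rewrite le_eqVlt.
  by move=> /predU1P[//|yx]; case: Y0; exists y.
have [|m [Xm mx] mmax] := Xmax [set y | X y /\ y < x] _ Y0.
  by move=> y [].
have mfin : finite_set [set y | X y /\ y <= m].
  apply: contrapT => minf.
  by have := xmin m (conj Xm minf); rewrite og_leNgt mx.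
have fU : finite_set ([set y | X y /\ y <= m] `|` [set x]).
  by rewrite finite_setU; split => //; exact: finite_set1.
apply: sub_finite_set fU => y [Xy]; rewrite le_eqVlt.
by move=> /predU1P[->|yx]; [right|left; split => //; apply: mmax].
Qed.

Lemma well_orderedD A B : well_ordered A -> well_ordered B ->
  well_ordered [set c | exists a b, [/\ A a, B b & c = a + b]].
Proof.
move=> /well_orderedP Awo /well_orderedP Bwo.
pose leftmin (C : set G) a0 := forall a b, A a -> B b -> C (a + b) -> a0 <= a.
pose bad b := B b /\ exists C a, [/\ C `<=` [set c | exists a b,
    [/\ A a, B b & c = a + b]], A a, C (a + b), leftmin C a &
    ~ exists2 x, C x & forall y, C y -> x <= y].
apply/well_orderedP => C sC C0.
apply: contrapT => Cbad.
have min_exists (D : set G) : D `<=` [set c | exists a b,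
    [/\ A a, B b & c = a + b]] -> D !=set0 ->
    exists a b, [/\ A a, B b, D (a + b) & leftmin D a].
  move=> sD [d Dd].
  have [||a [Aa [b Bb Dab]] amin] :=
      Awo [set a | A a /\ exists2 b, B b & D (a + b)].
  - by move=> a [].
  - have [a [b [Aa Bb dE]]] := sD _ Dd.
    by exists a; split => //; exists b; rewrite -?dE.
  exists a, b; split => // a' b' Aa' Bb' Dab'; apply: amin.
  by split => //; exists b'.
have [||b [Bb [D [a [sD Aa Dab Dmin Dbad]]]] bmin] := Bwo bad.
- by move=> b [].
- have [a [b [Aa Bb Cab Cmin]]] := min_exists C sC C0.
  by exists b; split => //; exists C, a; split.
pose D' := [set d | D d /\ d < a + b].
have sD' : D' `<=` D by move=> d [].
have D'0 : D' !=set0.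
  apply: contrapT => D'0; apply: Dbad; exists (a + b) => // d Dd.
  by rewrite og_leNgt; apply/negP => dab; apply: D'0; exists d.
have [a' [b' [Aa' Bb' D'ab D'min]]] :=
  min_exists D' (subset_trans sD' sD) D'0.
have bb' : b' < b.
  have aa' : a <= a' by apply: (Dmin _ b') => //; exact: sD'.
  rewrite -(og_ltD2l a); case: D'ab => _; apply: le_lt_trans.
  by rewrite og_leD2r.
suff /bmin : bad b' by rewrite og_leNgt bb'.
split => //; exists D', a'; split => //.
  exact: subset_trans sD' sD.
move=> [x [Dx xab] xmin]; apply: Dbad; exists x => // y Dy.
have [yab|] := og_ltP y (a + b); first exact: xmin.
by apply: le_trans; apply: ltW.
Qed.

Arguments well_orderedD : clear implicits.
Arguments well_orderedD {A B}.

End WellOrdered.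

Arguments sub_well_ordered {G A B}.
Arguments well_ordered1 {G}.
Arguments well_orderedU {G A B}.
Arguments well_orderedD {G A B}.

Definition supp (k : fieldType) (G : Type) (s : G -> k) : set G :=
  [set g | s g != 0].

Record hahn (k : fieldType) (G : orderedGroupType) := Hahn {
  hcoef :> G -> k;
  hahn_wo : well_ordered (supp hcoef)
}.

Arguments hahn_wo : clear implicits.
Arguments hahn_wo {k G}.

HB.instance Definition _ (k : fieldType) (G : orderedGroupType) :=
  gen_eqMixin (hahn k G).
HB.instance Definition _ (k : fieldType) (G : orderedGroupType) :=
  gen_choiceMixin (hahn k G).

Section HahnField.
Variables (k : fieldType) (G : orderedGroupType).
Implicit Types s p q : hahn k G.

Lemma hahnP s p : s =1 p -> s = p.
Proof.
case: s p => [s swo] [p pwo] /= /funext sp.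
by rewrite -sp in pwo *; congr Hahn; apply: Prop_irrelevance.
Qed.

Lemma supp0_wo : @well_ordered G (supp (fun=> 0 : k)).
Proof.
by apply: (sub_well_ordered _ (@well_ordered0 G)) => g; rewrite /supp /= eqxx.
Qed.

Lemma suppN_wo s : well_ordered (supp (fun g => - s g)).
Proof.
by apply: (sub_well_ordered _ (hahn_wo s)) => g; rewrite /supp /= oppr_eq0.
Qed.

Lemma suppD_wo s p : well_ordered (supp (fun g => s g + p g)).
Proof.
apply: (sub_well_ordered _ (well_orderedU (hahn_wo s) (hahn_wo p))) => g.
rewrite /supp /=; have [->|sg] := eqVneq (s g) 0; last by left.
by rewrite add0r; right.
Qed.

Lemma suppM_wo s p :
  well_ordered (supp (fun g => \sum_(h \in [set: G]) s h * p (g - h))).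
Proof.
apply: (sub_well_ordered _ (well_orderedD (hahn_wo s) (hahn_wo p))) => g.
rewrite /supp /= => spg; apply: contrapT => nsp.
case/eqP: spg; apply: fsbig1 => h _.
apply/eqP; apply: contrapT => /negP; rewrite mulf_eq0 negb_or => /andP[sh ph].
by apply: nsp; exists h, (g - h); split => //; rewrite addrC subrK.
Qed.

Lemma suppC_wo (a : k) (g : G) :
  @well_ordered G (supp (fun h => if h == g then a else 0)).
Proof.
apply: (sub_well_ordered _ (well_ordered1 g)) => h; rewrite /supp /=.
by case: (h =P g) => [->//|_]; rewrite eqxx.
Qed.

Arguments suppN_wo : clear implicits.
Arguments suppD_wo : clear implicits.
Arguments suppM_wo : clear implicits.
Arguments suppC_wo : clear implicits.

Definition hahn_zero := Hahn supp0_wo.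
Definition hahn_opp s := Hahn (suppN_wo s).
Definition hahn_add s p := Hahn (suppD_wo s p).
Definition hahn_mul s p := Hahn (suppM_wo s p).
Definition hahn_monom (a : k) (g : G) := Hahn (suppC_wo a g).

Fact hahn_addA : associative hahn_add.
Proof. by move=> s p q; apply: hahnP => g /=; rewrite addrA. Qed.
Fact hahn_addC : commutative hahn_add.
Proof. by move=> s p; apply: hahnP => g /=; rewrite addrC. Qed.
Fact hahn_add0 : left_id hahn_zero hahn_add.
Proof. by move=> s; apply: hahnP => g /=; rewrite add0r. Qed.
Fact hahn_addN : left_inverse hahn_zero hahn_opp hahn_add.
Proof. by move=> s; apply: hahnP => g /=; rewrite addNr. Qed.

HB.instance Definition _ :=
  GRing.isZmodule.Build (hahn k G) hahn_addA hahn_addC hahn_add0 hahn_addN.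

Lemma fsum_seq (F : G -> k) (X : seq G) : uniq X ->
  (forall g, F g != 0 -> g \in X) ->
  \sum_(g \in [set: G]) F g = \sum_(g <- X) F g.
Proof.
move=> uX FX; rewrite (fsbigE X) //.
  by apply: eq_bigl => g; rewrite in_setT.
move=> g _ gX; apply/eqP; apply: contraT => /FX.
by rewrite (negPf gX).
Qed.

Lemma mul_support s p g : exists2 X : seq G, uniq X &
  forall h, h \in X <-> (s h != 0 /\ p (g - h) != 0).
Proof.
have /finite_seqP[X XE] := wo_fiber_finite g (hahn_wo s) (hahn_wo p).
exists (undup X); first exact: undup_uniq.
by move=> h; rewrite mem_undup; have /= <- := congr1 (@^~ h) XE.
Qed.

Fact hahn_mulC : commutative hahn_mul.
Proof.
move=> s p; apply: hahnP => g /=.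
rewrite (@reindex_fsbigT _ _ _ _ _ (fun h => g - h)) /=; last first.
  by exists (fun h => g - h) => h; rewrite subKr.
by apply: eq_fsbigr => h _; rewrite subKr mulrC.
Qed.

Fact hahn_mulDl : left_distributive hahn_mul hahn_add.
Proof.
move=> s p q; apply: hahnP => g /=.
have [X uX XE] := mul_support s q g; have [Y uY YE] := mul_support p q g.
pose Z := undup (X ++ Y).
have hZ h : (h \in Z) = (h \in X) || (h \in Y) by rewrite mem_undup mem_cat.
have inX h : s h * q (g - h) != 0 -> h \in Z.
  by rewrite mulf_eq0 negb_or hZ => /andP/XE->.
have inY h : p h * q (g - h) != 0 -> h \in Z.
  by rewrite mulf_eq0 negb_or hZ => /andP/YE->; rewrite orbT.
rewrite !(@fsum_seq _ Z) ?undup_uniq //.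
  by rewrite -big_split /=; apply: eq_bigr => h _; rewrite mulrDl.
move=> h; rewrite mulrDl.
have [->|/inX//] := eqVneq (s h * q (g - h)) 0.
by rewrite add0r => /inY.
Qed.

Fact hahn_mulA : associative hahn_mul.
Proof.
move=> s p q; apply: hahnP => g; apply/esym => /=.
have [H uH HE] := mul_support (hahn_mul s p) q g.
have [F uF FE] : exists2 X : seq G, uniq X & forall h, h \in X <-> (s h != 0 /\
    (exists a b, [/\ p a != 0, q b != 0 & g - h = a + b])).
  have := wo_fiber_finite g (hahn_wo s)
    (well_orderedD (hahn_wo p) (hahn_wo q)).
  move=> /finite_seqP[X XE]; exists (undup X); first exact: undup_uniq.
  by move=> h; rewrite mem_undup; have /= <- := congr1 (@^~ h) XE.
have [K uK KE] : exists2 X : seq G, uniq X & forall h, h \in X <->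
    ((exists a b, [/\ s a != 0, p b != 0 & h = a + b]) /\ q (g - h) != 0).
  have := wo_fiber_finite g (well_orderedD (hahn_wo s) (hahn_wo p))
    (hahn_wo q).
  move=> /finite_seqP[X XE]; exists (undup X); first exact: undup_uniq.
  by move=> h; rewrite mem_undup; have /= <- := congr1 (@^~ h) XE.
transitivity (\sum_(h <- K) \sum_(i <- F) s i * p (h - i) * q (g - h)).
  rewrite (@fsum_seq _ K) //.
    apply: eq_bigr => h _.
    have [->|qgh] := eqVneq (q (g - h)) 0.
      by rewrite mulr0 big1 // => i _; rewrite mulr0.
    rewrite -mulr_suml; congr (_ * _); apply: fsum_seq => // i.
    rewrite mulf_eq0 negb_or => /andP[si ph]; apply/FE; split => //.
    by exists (h - i), (g - h); split => //; rewrite [RHS]addrC addrA subrK.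
  move=> h; rewrite mulf_eq0 negb_or => /andP[sph qgh].
  apply/KE; split => //; apply: contrapT => nsp; case/eqP: sph.
  apply: fsbig1 => i _; apply/eqP; apply: contrapT => /negP.
  rewrite mulf_eq0 negb_or => /andP[si pi]; apply: nsp; exists i, (h - i).
  by split => //; rewrite addrC subrK.
rewrite exchange_big /= (@fsum_seq _ F) //; last first.
  move=> i; rewrite mulf_eq0 negb_or => /andP[si pq]; apply/FE; split => //.
  apply: contrapT => npq; case/eqP: pq; apply: fsbig1 => j _.
  apply/eqP; apply: contrapT => /negP; rewrite mulf_eq0 negb_or => /andP[pj qj].
  by apply: npq; exists j, (g - i - j); split => //; rewrite [RHS]addrC subrK.
apply: eq_bigr => i _.
rewrite (@reindex_fsbigT _ _ _ _ _ (fun h => h - i)) /=; last first.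
  by exists (fun h => h + i) => h; rewrite ?addrK ?subrK.
have [->|si] := eqVneq (s i) 0.
  by rewrite mul0r big1 // => h _; rewrite !mul0r.
rewrite (@fsum_seq _ K) //.
  rewrite mulr_sumr; apply: eq_bigr => h _.
  by rewrite mulrA; congr (_ * q _); rewrite opprB addrA subrK.
move=> h; rewrite opprB addrA subrK mulf_eq0 negb_or => /andP[ph qh].
apply/KE; split => //; exists i, (h - i); split => //.
by rewrite addrC subrK.
Qed.

Lemma hahn_monomM a g s h : hahn_mul (hahn_monom a g) s h = a * s (h - g).
Proof.
rewrite /= (@fsum_seq _ [:: g]) // ?big_seq1 ?eqxx //.
move=> i; rewrite inE; case: (i == g) => //.
by rewrite mul0r eqxx.
Qed.

Fact hahn_mul1 : left_id (hahn_monom 1 0) hahn_mul.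
Proof. by move=> s; apply: hahnP => g; rewrite hahn_monomM mul1r subr0. Qed.

Fact hahn_one_neq0 : hahn_monom 1 0 != 0 :> hahn k G.
Proof.
apply/eqP => /(congr1 (fun s : hahn k G => s 0)) /=.
by rewrite eqxx; apply/eqP; exact: oner_neq0.
Qed.

HB.instance Definition _ :=
  GRing.Zmodule_isComNzRing.Build (hahn k G) hahn_mulA hahn_mulC hahn_mul1
    hahn_mulDl hahn_one_neq0.

Lemma hcoef0 g : (0 : hahn k G) g = 0. Proof. by []. Qed.
Lemma hcoef1 g : (1 : hahn k G) g = (g == 0)%:R.
Proof. by rewrite /=; case: (g == 0). Qed.
Lemma hcoefD s p g : (s + p) g = s g + p g. Proof. by []. Qed.
Lemma hcoefN s g : (- s) g = - s g. Proof. by []. Qed.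
Lemma hcoefB s p g : (s - p) g = s g - p g. Proof. by []. Qed.
Lemma hcoefM s p g :
  (s * p) g = \sum_(h \in [set: G]) s h * p (g - h).
Proof. by []. Qed.

Lemma hahn_neq0P s : s != 0 <->
  exists2 g, s g != 0 & forall h, s h != 0 -> g <= h.
Proof.
split=> [s0|[g sg _]]; last by apply: contraNneq sg => ->.
have /well_orderedP/(_ _ (@subset_refl _ _)) := hahn_wo s.
apply; apply: contrapT => ns; case/eqP: s0; apply: hahnP => g.
by apply/eqP; apply: contrapT => /negP sg; apply: ns; exists g.
Qed.

(* Every nonzero series is invertible: by Zorn's lemma there is a maximal
   partial solution [s] of [q * s = 1], ordered by truncation. *)
Lemma hahn_inv_exists q : q != 0 -> exists s, s * q = 1.
Proof.
move=> /hahn_neq0P[v qv vmin].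
have qlt h : h < v -> q h = 0.
  by move=> hv; apply/eqP; apply: contraTT hv => /vmin; rewrite og_leNgt.
pose trunc s s' := forall g h, s g != 0 -> h <= g -> s' h = s h.
pose part s := forall g h, s g != 0 -> h <= g + v -> (1 - q * s) h = 0.
pose T := {s : hahn k G | part s}.
have [||||[s sP] smax] := @Zorn T (fun x y => `[< trunc (sval x) (sval y) >]).
- by move=> x; apply/asboolP => g h.
- move=> x y z /asboolP xy /asboolP yz; apply/asboolP => g h xg hg.
  by rewrite -(xy g h xg hg) (yz g) // (xy g).
- move=> [x xP] [y yP] /asboolP /= xy /asboolP /= yx.
  suff exy : x = y by move: xP yP; rewrite exy => xP yP; congr exist;
    apply: Prop_irrelevance.
  apply: hahnP => g; have [xg|xg] := eqVneq (x g) 0; last by rewrite (xy g).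
  by have [yg|yg] := eqVneq (y g) 0; [rewrite xg yg|rewrite (yx g)].
- move=> F Ftot.
  pose val g (a : k) := exists2 x : T, F x & sval x g = a /\ a != 0.
  pose u g : k := xget 0 (val g).
  have uE x g h : F x -> sval x g != 0 -> h <= g -> u h = sval x h.
    move=> Fx xg hg; rewrite /u; case: xgetP => [_ -> [y Fy [<- yh]]|nval].
      have [/asboolP xy|/asboolP yx] := Ftot _ _ Fx Fy; first exact: (xy g).
      by rewrite (yx h).
    apply/eqP; rewrite eq_sym; apply: contrapT => /negP xh.
    by apply: (nval (sval x h)); exists x.
  have uN0 g : u g != 0 -> exists2 x : T, F x & sval x g != 0.
    rewrite /u; case: xgetP => [_ -> [y Fy [<- yg]] _|_ /eqP//].
    by exists y.
  have uwo : well_ordered (supp u).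
    apply/well_orderedP => B sB [b Bb].
    have [x Fx xb] := uN0 _ (sB _ Bb).
    have /well_orderedP/(_ [set c | B c /\ c <= b]) := hahn_wo (sval x).
    case.
    + move=> c [Bc cb]; have := sB _ Bc.
      by rewrite /supp /= (uE x b).
    + by exists b.
    move=> c [Bc cb] cmin; exists c => // d Bd.
    have [db|/ltW bd] := og_leP d b; first exact: cmin.
    exact: le_trans bd.
  have uP : part (Hahn uwo).
    move=> g h /= /uN0[x Fx xg] hg.
    rewrite -[RHS](proj2_sig x g h xg hg) !hcoefB !hcoefM; congr (_ - _).
    apply: eq_fsbigr => i _; have [/qlt->|vi] := og_ltP i v; first by rewrite !mul0r.
    congr (_ * _); apply: uE xg _ => //.
    rewrite og_leBlD; apply: (le_trans hg); by rewrite og_leD2l.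
  by exists (exist _ _ uP) => x Fx; apply/asboolP => g h xg hg; apply: uE xg hg.
exists s; rewrite mulrC; apply/eqP; rewrite eq_sym -subr_eq0.
apply: contrapT => /negP /hahn_neq0P[w rw wmin].
have wgt g : s g != 0 -> g < w - v.
  move=> sg; rewrite og_ltBrD og_ltNge; apply/negP => wgv.
  by case/eqP: rw; exact: (sP g w sg wgv).
have swv : s (w - v) = 0.
  by apply/eqP; apply: contrapT => /negP/wgt; rewrite ltxx.
have rlt h : h < w -> (1 - q * s) h = 0.
  by move=> hw; apply/eqP; apply: contraTT hw => /wmin; rewrite og_leNgt.
pose a := (1 - q * s) w / q v.
pose s' := s + hahn_monom a (w - v).
have s'E h : s' h = s h + (if h == w - v then a else 0) by [].
have s'wv : s' (w - v) != 0.
  by rewrite s'E eqxx swv add0r mulf_neq0 ?invr_eq0.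
have s'P : part s'.
  move=> g h s'g hg.
  have gw : g <= w - v.
    have [/wgt/ltW//|] := boolP (s g != 0); rewrite negbK => /eqP sg.
    by move: s'g; rewrite s'E sg; case: (g =P _) => [->//|_]; rewrite addr0 eqxx.
  have hw : h <= w by apply: (le_trans hg); rewrite -(subrK v w) og_leD2r.
  rewrite mulrDr opprD addrA hcoefD hcoefN [q * hahn_monom _ _]mulrC.
  rewrite [X in _ - X]hahn_monomM.
  move: hw; rewrite le_eqVlt => /predU1P[->|hw].
    by rewrite subKr /a divfK ?subrr.
  rewrite rlt // qlt ?mulr0 ?subrr // opprB addrCA -[ltRHS]addr0 og_ltD2l.
  by rewrite -(og_ltD2r w) subrK add0r.
have ss' : trunc s s'.
  move=> g h /wgt gw hg; rewrite s'E; case: (h =P _) => [hE|]; last by rewrite addr0.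
  by move: gw; rewrite -hE og_ltNge hg.
have := smax (exist _ _ s'P); rewrite /=.
move=> /(_ (asboolT ss'))/(congr1 sval) /= s'Es.
by move: s'wv; rewrite s'Es swv eqxx.
Qed.

Definition hahn_inv q : hahn k G :=
  if pselect (q != 0) is left q0 then projT1 (cid (hahn_inv_exists q0)) else 0.

Fact hahn_mulV q : q != 0 -> hahn_inv q * q = 1.
Proof. by rewrite /hahn_inv; case: pselect => // q0 _; case: cid. Qed.

Fact hahn_inv0 : hahn_inv 0 = 0.
Proof. by rewrite /hahn_inv; case: pselect => // n0; case/eqP: (n0). Qed.

HB.instance Definition _ :=
  GRing.ComNzRing_isField.Build (hahn k G) hahn_mulV hahn_inv0.

End HahnField.

Definition fractions (F : fieldType) (A : set F) : set F :=
  [set s | exists p q, [/\ A p, A q, q != 0 & s = p / q]].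

Definition group_algebra (k : fieldType) (G : orderedGroupType) :
    set (hahn k G) :=
  [set s | finite_set (supp s)].
Arguments group_algebra : clear implicits.

Definition min_hahn (k : fieldType) (G : orderedGroupType) : set (hahn k G) :=
  fractions (group_algebra k G).
Arguments min_hahn : clear implicits.

Definition hahn_field (k : fieldType) (G : orderedGroupType)
    (K : set (hahn k G)) : Prop :=
  GRing.divring_closed [in K] /\ min_hahn k G `<=` K.

(* A partial function is a function to [option k], its domain being the set of
   arguments that are not sent to [None]. *)
Definition pdom (k G : Type) (r : G -> option k) : set G :=
  [set g | isSome (r g)].

Record lrs (k : fieldType) (G : orderedGroupType) := Lrs {
  lrs_fun :> G -> option k;
  lrs_wo : well_ordered (pdom lrs_fun)
}.

Definition lrs_nontrivial (k : fieldType) (G : orderedGroupType)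
    (r : lrs k G) : Prop :=
  exists g a, r g = Some a /\ a != 0.

(* The value [odflt 0 (r g)] is only used for [g] in the domain of [r]. The
   sum has finitely many nonzero terms, as the domain of [r] and the support
   of [s] are well-ordered. *)
Definition lrs_solutions (k : fieldType) (G : orderedGroupType)
    (r : lrs k G) : set (hahn k G) :=
  [set s | forall h, ~ pdom r h ->
    \sum_(g \in pdom r) odflt 0 (r g) * s (h - g) = 0].

Definition lrs_span (k : fieldType) (G : orderedGroupType)
    (R : set (lrs k G)) : set (hahn k G) :=
  \bigcup_(r in R) lrs_solutions r.

Definition lrs_determined (k : fieldType) (G : orderedGroupType)
    (S : set (hahn k G)) : Prop :=
  exists R : set (lrs k G), S = lrs_span R.

Definition lrs_dom_in (k : fieldType) (G : orderedGroupType)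
    (F : set (set G)) : set (lrs k G) :=
  [set r | lrs_nontrivial r /\ F (pdom r)].
Arguments lrs_dom_in k {G} F.

Definition Zlex (n : nat) : Type := 'rV[int]_n.

HB.instance Definition _ n := GRing.Zmodule.on (Zlex n).

Definition Zlex_lt n (u v : Zlex n) : bool :=
  [exists i : 'I_n, (u ord0 i < v ord0 i) &&
     [forall j : 'I_n, (j < i)%N ==> (u ord0 j == v ord0 j)]].

Section ZlexOrder.
Variable n : nat.
Implicit Types u v w : Zlex n.

Lemma Zlex_ltP u v : reflect
  (exists2 i : 'I_n, u ord0 i < v ord0 i &
     forall j : 'I_n, (j < i)%N -> u ord0 j = v ord0 j)
  (Zlex_lt u v).
Proof.
apply: (iffP existsP) => [[i /andP[uvi /forallP uvj]]|[i uvi uvj]].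
  by exists i => // j ji; apply/eqP; have := uvj j; rewrite ji.
by exists i; rewrite uvi; apply/forallP => j; apply/implyP => /uvj->.
Qed.

Fact Zlex_lt_irr : irreflexive (@Zlex_lt n).
Proof. by move=> u; apply/Zlex_ltP => -[i]; rewrite ltxx. Qed.

Fact Zlex_lt_trans : transitive (@Zlex_lt n).
Proof.
move=> v u w /Zlex_ltP[i uvi uvj] /Zlex_ltP[i' vwi vwj]; apply/Zlex_ltP.
have [ii'|i'i|/val_inj ii'] := ltngtP i i'.
- exists i => [|j ji]; first by rewrite -vwj.
  by rewrite uvj // vwj // (ltn_trans ji).
- exists i' => [|j ji]; first by rewrite uvj.
  by rewrite uvj ?vwj // (ltn_trans ji).
- subst i'; exists i => [|j ji]; first exact: lt_trans vwi.
  by rewrite uvj ?vwj.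
Qed.

HB.instance Definition _ :=
  Order.Lt_isPOrder.Build ring_display (Zlex n) Zlex_lt_irr Zlex_lt_trans.

Fact Zlex_total u v : (u <= v) || (v <= u).
Proof.
rewrite !le_eqVlt [v == u]eq_sym; case: eqVneq => //= uv.
have [i0 uvi0] : exists i, u ord0 i != v ord0 i.
  apply: contrapT => nuv; case/eqP: uv; apply/rowP => i; apply/eqP.
  by apply: contrapT => /negP uvi; apply: nuv; exists i.
case: (@arg_minnP _ i0 (fun i => u ord0 i != v ord0 i) val uvi0) => i uvi imin.
have uvj (j : 'I_n) : (j < i)%N -> u ord0 j = v ord0 j.
  by move=> ji; apply/eqP; apply: contraTT ji => /imin; rewrite -leqNgt.
move: uvi; case: ltgtP => // uvi _; apply/orP; [left|right].
  by apply/Zlex_ltP; exists i.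
by apply/Zlex_ltP; exists i => // j /uvj.
Qed.

Fact Zlex_leD2l w u v : u <= v -> w + u <= w + v.
Proof.
rewrite !le_eqVlt => /predU1P[->|/Zlex_ltP[i uvi uvj]]; first by rewrite eqxx.
apply/orP; right; apply/Zlex_ltP; exists i; first by rewrite !mxE ltrD2l.
by move=> j ji; rewrite !mxE uvj.
Qed.

HB.instance Definition _ :=
  POrderedZmodule_isOrderedGroup.Build (Zlex n) Zlex_total Zlex_leD2l.

Definition orthant : set (Zlex n) := [set g | forall i, 0 <= g ord0 i].

End ZlexOrder.

Arguments orthant : clear implicits.

Lemma orthant_wo n : @well_ordered (Zlex n) (orthant n).
Proof.
apply/well_orderedP => B sB B0.
suff: forall m, exists2 a, B a & forall c, B c ->
    (forall i : 'I_n, (i < m)%N -> a ord0 i = c ord0 i) \/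
    (exists i : 'I_n, [/\ (i < m)%N, a ord0 i < c ord0 i &
       forall j : 'I_n, (j < i)%N -> a ord0 j = c ord0 j]).
  move=> /(_ n)[a Ba aP]; exists a => // c /aP[ac|[i [_ aci acj]]].
    by rewrite le_eqVlt; apply/orP; left; apply/eqP/rowP => i; apply: ac.
  by apply: ltW; apply/Zlex_ltP; exists i.
elim=> [|m [a Ba aP]].
  by have [a Ba] := B0; exists a => // c _; left.
have [nm|mn] := leqP n m.
  exists a => // c /aP[ac|[i [im aci acj]]]; [left => i _|right].
    by apply: ac; exact: leq_trans nm.
  by exists i; split => //; exact: ltnW.
pose i0 := Ordinal mn.
pose P (x : nat) := `[< exists c, [/\ B c, c ord0 i0 = x%:Z &
  forall i : 'I_n, (i < m)%N -> a ord0 i = c ord0 i] >].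
have [|x /asboolP[b [Bb bx ab]] xmin] := @ex_minnP P.
  exists `|a ord0 i0|%N; apply/asboolP; exists a; split => //.
  by rewrite gez0_abs // (sB _ Ba).
exists b => // c Bc; have [ac|[i [im aci acj]]] := aP _ Bc; last first.
  right; exists i; split; first exact: ltnW.
    by rewrite -ab.
  by move=> j ji; rewrite -ab ?acj // (ltn_trans ji).
have : (x <= `|c ord0 i0|)%N.
  by apply: xmin; apply/asboolP; exists c; rewrite gez0_abs // (sB _ Bc).
rewrite -lez_nat gez0_abs ?(sB _ Bc) // -bx le_eqVlt => /predU1P[bc|bc].
  left => i; rewrite ltnS leq_eqVlt => /predU1P[im|im]; last by rewrite -ab ?ac.
  by have -> : i = i0 by exact: val_inj.
right; exists i0; split => // j jm; by rewrite -ab ?ac.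
Qed.
Arguments orthant_wo : clear implicits.

Definition expvec n (g : Zlex n) : mpoly.multinom n :=
  mpoly.Multinom [tuple `|g ord0 i|%N | i < n].

Section PowerSeries.
Variables (k : fieldType) (n : nat).

Lemma powser_wo (a : mpoly.multinom n -> k) : @well_ordered (Zlex n)
  (supp (fun g => if `[< orthant n g >] then a (expvec g) else 0)).
Proof.
apply: (sub_well_ordered _ (orthant_wo n)) => g; rewrite /supp /=.
by case: asboolP => // _; rewrite eqxx.
Qed.
Arguments powser_wo : clear implicits.

(* The map sending [\sum_m a m x^m] to [\sum_m a m t^m]; a formal power series
   in n variables is given by the family of its coefficients. *)
Definition hahn_of_powser (a : mpoly.multinom n -> k) : hahn k (Zlex n) :=
  Hahn (powser_wo a).

Definition powser : set (hahn k (Zlex n)) := range hahn_of_powser.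

Definition polynom : set (hahn k (Zlex n)) :=
  range (fun p : mpoly.mpoly n k => hahn_of_powser (fun m => mpoly.mcoeff m p)).

Definition powser_frac : set (hahn k (Zlex n)) := fractions powser.

Definition polynom_frac : set (hahn k (Zlex n)) := fractions polynom.

Lemma powserE : powser = [set s | supp s `<=` orthant n].
Proof.
apply/seteqP; split=> [_ [a _ <-] g|s sP]; rewrite /supp /=.
  by case: asboolP => // _; rewrite eqxx.
exists (fun m => s (\row_i (mpoly.fun_of_multinom m i)%:Z)) => //.
apply: hahnP => g /=; case: asboolP => gP.
  congr (s _); apply/rowP => i; rewrite mxE /mpoly.fun_of_multinom.
  by rewrite tnth_mktuple gez0_abs.
by apply/esym/eqP; apply: contraT => /sP.
Qed.

End PowerSeries.

Arguments powser : clear implicits.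
Arguments polynom : clear implicits.
Arguments powser_frac : clear implicits.
Arguments polynom_frac : clear implicits.

Definition square_exp (n i : nat) : Zlex n :=
  \row_(j < n) (if val j is 0%N then (i ^ 2)%N%:Z
                else if val j is 1%N then - i%:Z else 0).

Section SquareSeries.
Variables (k : fieldType) (n : nat).

Lemma square_exp_le i j : (i <= j)%N -> square_exp n i <= square_exp n j.
Proof.
rewrite leq_eqVlt => /predU1P[->//|ij]; case: n => [|m].
  by rewrite le_eqVlt; apply/orP; left; apply/eqP/rowP => -[].
apply: ltW; apply/Zlex_ltP; exists ord0 => //.
by rewrite !mxE /= ltz_nat ltn_sqr.
Qed.

Lemma square_series_wo : @well_ordered (Zlex n)
  (supp (fun g => if `[< range (square_exp n) g >] then 1 else 0 : k)).
Proof.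
apply/well_orderedP => B sB [b Bb].
pose P i := `[< B (square_exp n i) >].
have sBP c : B c -> exists2 i, P i & c = square_exp n i.
  move=> Bc; have := sB _ Bc; rewrite /supp /=.
  case: asboolP => [[i _ ci] _|]; last by rewrite eqxx.
  by exists i => //; apply/asboolP; rewrite ci.
have [|i /asboolP Bi imin] := @ex_minnP P.
  by have [i Pi _] := sBP _ Bb; exists i.
exists (square_exp n i) => // c /sBP[j /imin ij ->].
exact: square_exp_le.
Qed.

(* The series [\sum_i t^(square_exp n i)]: for n positive, the exponents are
   pairwise distinct. *)
Definition square_series : hahn k (Zlex n) := Hahn square_series_wo.

End SquareSeries.

Arguments square_series : clear implicits.

(* Main.v *)
(** A quotient of power series is a series whose product with some nonzero
    power series is supported in the orthant, and the vanishing of that product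
    outside the orthant is a linear recurrence relation: this gives (ii).
    Multiplying by a monomial with large exponents moves any finite support into
    the orthant, and for n = 1 any well-ordered support: this gives (i) and the
    first part of (iv).

    The separations in (iii) and (iv) use lacunary series s = sum_i t^(a_i).
    If g0 is in supp(q) and i is so large that g0 + a_i - a_j is outside
    supp(q) for all j <> i, then the coefficient of s q at a_i + g0 is
    q_g0 <> 0; hence s q has nonzero coefficients at a_i + g0 for all large i.
    For a_i = (i^2, 0, ..., 0) and finite supp(q), this makes supp(s q)
    infinite. For a_i = (i^2, -i, 0, ..., 0) and supp(q) in the orthant, take
    g0 in supp(q) with least second coordinate: the second coordinate excludes
    j < i, the first one excludes j > i, and supp(s q) leaves the orthant. *)
Require Import Defs.
From mathcomp Require Import all_boot all_order all_algebra.
From mathcomp Require Import boolp classical_sets functions cardinality fsbigop.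
From mathcomp Require Import zify.
(* Importing mpoly makes its canonical structures available; its notations
   clash with those of MathComp-Analysis. *)
From mathcomp Require mpoly.
Import -(notations) mpoly.

Set Implicit Arguments.
Unset Strict Implicit.
Unset Printing Implicit Defensive.

Import Order.TTheory GRing.Theory Num.Theory.
Local Open Scope classical_set_scope.
Local Open Scope ring_scope.

(** * Quotients of elements of a subring *)

Section Fractions.
Variable F : fieldType.
Implicit Types A B : set F.

Lemma sub_fractions A B : A `<=` B -> fractions A `<=` fractions B.
Proof. by move=> AB _ [p [q [/AB Bp /AB Bq q0 ->]]]; exists p, q. Qed.

Lemma fractions_divring_closed A :
  GRing.subring_closed [in A] -> GRing.divring_closed [in fractions A].
Proof.
case=> A1 AB AM.
have A0 : 0 \in [in A] by rewrite -(subrr 1) AB.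
have AD x y : x \in [in A] -> y \in [in A] -> x + y \in [in A].
  by move=> Ax Ay; rewrite -[y]opprK AB // -sub0r AB.
split=> [|x y|x y]; rewrite !inE in A1 A0 *.
- by exists 1, 1; split; rewrite ?oner_neq0 ?divr1.
- move=> [p [q [Ap Aq q0 ->]]] [p' [q' [Ap' Aq' q'0 ->]]].
  exists (p * q' - p' * q), (q * q'); split; rewrite ?mulf_neq0 //.
  + by apply/set_mem/AB; apply: AM; rewrite inE.
  + by apply/set_mem/AM; rewrite inE.
  by rewrite -mulNr addf_div // mulNr.
(* Closure under division includes division by 0, whose inverse is 0 by convention, so [p' = 0]
   gives the quotient [0 / 1]. *)
- move=> [p [q [Ap Aq q0 ->]]] [p' [q' [Ap' Aq' q'0 ->]]].
  have [->|p'0] := eqVneq p' 0.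
    by exists 0, 1; split; rewrite ?oner_neq0 ?mul0r ?invr0 ?mulr0.
  exists (p * q'), (q * p'); split; rewrite ?mulf_neq0 //.
  + by apply/set_mem/AM; rewrite inE.
  + by apply/set_mem/AM; rewrite inE.
  by rewrite invf_div mulf_div.
Qed.

End Fractions.

(** * Supports and coefficients of products of Hahn series *)

Section HahnSeries.
Variables (k : fieldType) (G : orderedGroupType).
Implicit Types s p q : hahn k G.

Lemma hcoefM_neq0 s p g : (s * p) g != 0 ->
  exists h, [/\ s h != 0, p (g - h) != 0 & h + (g - h) = g].
Proof.
move=> spg; apply: contrapT => nsp; case/eqP: spg; rewrite hcoefM.
apply: fsbig1 => h _; apply/eqP; apply: contrapT => /negP.
rewrite mulf_eq0 negb_or => /andP[sh ph].
by apply: nsp; exists h; split => //; rewrite addrC subrK.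
Qed.

Lemma supp_monom1M (g : G) s h :
  supp (hahn_monom 1 g * s) h -> supp s (h - g).
Proof. by have := hahn_monomM 1 g s h; rewrite mul1r /supp /= => ->. Qed.

Lemma hahn_monom_neq0 (a : k) (g : G) : a != 0 -> hahn_monom a g != 0.
Proof.
move=> a0; apply/eqP => /(congr1 (fun s : hahn k G => s g)) /=.
by rewrite eqxx; apply/eqP.
Qed.

Lemma group_algebra_subring : GRing.subring_closed [in group_algebra k G].
Proof.
split=> [|s p|s p]; rewrite !inE.
- apply: sub_finite_set (finite_set1 (0 : G)) => g; rewrite /supp /=.
  by case: (g =P 0) => // _; rewrite eqxx.
- move=> fs fp; have fU : finite_set (supp s `|` supp p) by rewrite finite_setU.
  apply: sub_finite_set fU => g; rewrite /supp /=.
  by have [->|sg] := eqVneq (s g) 0; [rewrite sub0r oppr_eq0; right|left].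
- move=> fs fp.
  have fD : finite_set [set a + b | a in supp s & b in supp p].
    exact: finite_image2.
  apply: sub_finite_set fD => g /hcoefM_neq0[h [sh ph <-]].
  by exists h => //; exists (g - h).
Qed.

Lemma group_algebra_monomM (a : k) (g : G) s :
  group_algebra k G s -> group_algebra k G (hahn_monom a g * s).
Proof.
move=> fs; suff : (hahn_monom a g * s) \in group_algebra k G by rewrite inE.
have [_ _ gM] := group_algebra_subring; apply: gM; rewrite inE //.
apply: sub_finite_set (finite_set1 g) => h; rewrite /supp /=.
by case: (h =P g) => // _; rewrite eqxx.
Qed.

(** Extending [r] by zero to a series [q] adds only zero terms, so recurrence relations become
    statements about coefficients of products. *)
Lemma lrs_sumE (r : lrs k G) q s h : (forall g, odflt 0 (r g) = q g) ->
  \sum_(g \in pdom r) odflt 0 (r g) * s (h - g) = (q * s) h.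
Proof.
move=> rq; rewrite hcoefM [LHS]fsbig_mkcond; apply: eq_fsbigr => g _.
rewrite /patch -rq; case: ifPn => //; rewrite notin_setE /pdom /=.
by case: (r g) => // _; rewrite mul0r.
Qed.

(** In the convolution the term at [a j] with [j != i] contains a coefficient of [q] assumed to
    vanish, so only the term at [a i] remains. *)
Lemma lacunary_coefM (a : nat -> G) s q i g :
  (forall h, s h = if `[< range a h >] then 1 else 0) ->
  (forall j, j != i -> q (g + (a i - a j)) = 0) ->
  (s * q) (a i + g) = q g.
Proof.
move=> sE qE; rewrite hcoefM (@fsum_seq _ _ _ [:: a i]) // => [|h].
  rewrite big_seq1 sE; case: asboolP => [_|[]]; last by exists i.
  by rewrite mul1r addrAC subrr add0r.
rewrite sE inE; case: asboolP => [[j _ <-]|_]; last by rewrite mul0r eqxx.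
have [->|/qE] := eqVneq j i; first by rewrite eqxx.
by rewrite addrA [g + _]addrC => ->; rewrite mulr0 eqxx.
Qed.

End HahnSeries.

(** * Power series and polynomials as series supported in the orthant *)

Section PowerSeries.
Variables (k : fieldType) (n : nat).
Implicit Types s p q : hahn k (Zlex n).

Lemma powser_subring : GRing.subring_closed [in powser k n].
Proof.
split=> [|s p|s p]; rewrite !inE powserE.
- move=> g; rewrite /supp /=.
  by case: (g =P 0) => [-> _ i|_]; rewrite ?eqxx // mxE.
- move=> sP pP g; rewrite /supp /=.
  have [->|sg _] := eqVneq (s g) 0; last exact: sP.
  by rewrite sub0r oppr_eq0; apply: pP.
- move=> sP pP g /hcoefM_neq0[h [/sP sh /pP ph <-]] i.
  by rewrite mxE addr_ge0.
Qed.

(** [expvec] takes absolute values, which lose nothing on nonnegative coordinates. *)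
Lemma expvec_inj : {in orthant n &, injective (@expvec n)}.
Proof.
move=> g h; rewrite !inE => gP hP gh; apply/rowP => i.
have := congr1 (fun m => mpoly.fun_of_multinom m i) gh.
rewrite /mpoly.fun_of_multinom !tnth_mktuple => /(congr1 Posz).
by rewrite !gez0_abs.
Qed.

Lemma polynomE :
  polynom k n = [set s | finite_set (supp s) /\ supp s `<=` orthant n].
Proof.
apply/seteqP; split=> [_ [p _ <-]|s [/finite_seqP[X XE] sP]] /=.
  split; last first.
    have : powser k n (hahn_of_powser (fun m => mpoly.mcoeff m p)).
      by eexists.
    by rewrite powserE.
  have fX : finite_set
      [set \row_i (mpoly.fun_of_multinom m i)%:Z | m in
        [set` mpoly.msupp p]].
    exact/finite_image/finite_seq.
  apply: sub_finite_set fX => g; rewrite /supp /=.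
  case: asboolP => [gP|_]; last by rewrite eqxx.
  rewrite mpoly.mcoeff_eq0 negbK => gX; exists (expvec g) => //.
  apply/rowP => i; rewrite mxE /mpoly.fun_of_multinom tnth_mktuple.
  by rewrite gez0_abs.
have XP g : (g \in undup X) = (s g != 0).
  rewrite mem_undup; apply/idP/idP => [gX|sg].
    by have /= := congr1 (@^~ g) XE; rewrite /supp /= => ->.
  by have /= := congr1 (@^~ g) XE; rewrite /supp /= => <-.
exists (\sum_(g <- undup X) s g *: mpoly.mpolyX k (expvec g)) => //.
apply: hahnP => g /=; case: asboolP => gP; last first.
  by apply/esym/eqP; apply: contraT => /sP.
rewrite raddf_sum /=.
transitivity (\sum_(h <- undup X) if h == g then s g else 0).
  apply: eq_big_seq => h; rewrite XP => /sP hP.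
  rewrite mpoly.mcoeffZ mpoly.mcoeffX; have [->|hg] := eqVneq h g.
    by rewrite eqxx mulr1.
  case: eqP => [/expvec_inj hgE|_]; last by rewrite mulr0.
  by move: hg; rewrite hgE ?eqxx // inE.
have [sg|sg] := eqVneq (s g) 0; first by rewrite big1 // => h; case: eqP.
rewrite (bigD1_seq g) ?undup_uniq ?XP //= eqxx big1 ?addr0 // => h.
by move/negPf->.
Qed.


(** * Shifting finite supports into the orthant *)

Lemma Zlex_finite_bounded (A : set (Zlex n)) : finite_set A ->
  exists N : nat, forall g, A g -> forall i, (`|g ord0 i| < N)%N.
Proof.
move=> /finite_seqP[X ->].
exists (\max_(g <- X) \max_i `|g ord0 i|%N).+1 => g gX i; rewrite ltnS.
apply: leq_trans (leq_bigmax_seq _ gX isT).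
exact: (leq_bigmax i).
Qed.

Lemma fractions_monomM (A : set (hahn k (Zlex n))) g p q : q != 0 ->
  A (hahn_monom 1 g * p) -> A (hahn_monom 1 g * q) -> fractions A (p / q).
Proof.
move=> q0 Ap Aq; have m0 := hahn_monom_neq0 g (oner_neq0 k).
exists (hahn_monom 1 g * p), (hahn_monom 1 g * q).
by split; rewrite ?mulf_neq0 // -mulf_div divff ?mul1r.
Qed.

Lemma min_hahn_Zlex : min_hahn k (Zlex n) = polynom_frac k n.
Proof.
apply/seteqP; split; last first.
  by apply: sub_fractions; rewrite polynomE => s [].
move=> _ [p [q [fp fq q0 ->]]].
have [|N NP] := @Zlex_finite_bounded (supp p `|` supp q).
  by rewrite finite_setU.
(* [N] bounds all coordinates of both supports, so one shift by [(N, ..., N)] serves numerator and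
   denominator. *)
have shift s : group_algebra k (Zlex n) s -> supp s `<=` supp p `|` supp q ->
    polynom k n (hahn_monom 1 (const_mx N%:Z : Zlex n) * s).
  move=> fs spq; rewrite polynomE; split; first exact: group_algebra_monomM.
  move=> g /supp_monom1M/spq/NP gN i.
  by have := gN i; rewrite !mxE; move: (g ord0 i) => x; lia.
by apply: (fractions_monomM q0); apply: shift.
Qed.

Lemma polynom_frac_powser_frac : polynom_frac k n `<=` powser_frac k n.
Proof. by apply: sub_fractions; rewrite polynomE powserE => s []. Qed.

(** * Recurrence relations and quotients of power series *)

Lemma lrs_solutions_powser_frac (r : lrs k (Zlex n)) :
  lrs_nontrivial r -> pdom r `<=` orthant n ->
  lrs_solutions r `<=` powser_frac k n.
Proof.
move=> [g [a [rg a0]]] rP s sr.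
have rdom : supp (fun h => odflt 0 (r h)) `<=` pdom r.
  by move=> h; rewrite /supp /pdom /=; case: (r h) => //; rewrite eqxx.
pose q := Hahn (sub_well_ordered rdom (@lrs_wo _ _ r)).
have q0 : q != 0.
  apply/eqP => /(congr1 (fun s : hahn k (Zlex n) => s g)) /=.
  by rewrite rg; apply/eqP.
(* The relation says that [q * s] vanishes outside [pdom r]. *)
exists (q * s), q; rewrite powserE; split=> [h qsh|h /rdom/rP|//|] //.
  apply: rP; apply: contrapT => /sr.
  by rewrite (@lrs_sumE _ _ _ q) //; apply/eqP.
by rewrite mulrC mulKf.
Qed.

Lemma powser_frac_lrs :
  powser_frac k n `<=` lrs_span (lrs_dom_in k [set orthant n]).
Proof.
rewrite /powser_frac powserE => _ [p [q [pP qP q0 ->]]].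
(* Zeros of [q] in the orthant are kept as [Some 0], so that the domain is the whole orthant. *)
pose rf g := if `[< orthant n g >] then Some (q g) else None.
have rdom : pdom rf = orthant n.
  by apply/seteqP; split=> g; rewrite /pdom /rf /=; case: asboolP.
have rwo : well_ordered (pdom rf) by rewrite rdom; exact: orthant_wo.
exists (Lrs rwo); first split=> //.
  have [g qg _] := (hahn_neq0P q).1 q0; exists g, (q g); split => //=.
  by rewrite /rf; case: asboolP => // -[]; exact: qP.
move=> h rh; have hP : ~ orthant n h by rewrite -rdom.
rewrite (@lrs_sumE _ _ (Lrs rwo) q) => [|g].
  rewrite mulrCA divff // mulr1; apply/eqP; apply: contrapT => /negP ph.
  exact/hP/pP.
rewrite /= /rf; case: asboolP => //= gP; apply/esym/eqP; apply: contrapT.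
by move=> /negP/qP.
Qed.

(** * Comparison with the minimal and the maximal Hahn field *)

Lemma powser_frac_neq_polynom_frac :
  (0 < n)%N -> powser_frac k n <> polynom_frac k n.
Proof.
move=> n0; pose i0 := Ordinal n0.
pose a i : Zlex n := \row_j (if j == i0 then (i ^ 2)%N%:Z else 0).
have aP : supp (fun g => if `[< range a g >] then 1 else 0 : k) `<=` orthant n.
  move=> g; rewrite /supp /=; case: asboolP => [[i _ <-] _ j|_].
    by rewrite mxE; case: ifP.
  by rewrite eqxx.
pose s := Hahn (sub_well_ordered aP (orthant_wo n)) => E.
have : polynom_frac k n s.
  rewrite -E; exists s, 1; rewrite oner_neq0 divr1; split => //.
    by rewrite powserE.
  by have [+ _ _] := powser_subring; rewrite inE.
rewrite /polynom_frac polynomE => -[p [q [[fp _] [fq _] q0 sE]]].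
have spq : s * q = p by rewrite sE divfK.
have [|N NP] := @Zlex_finite_bounded (supp p `|` supp q).
  by rewrite finite_setU.
have [g qg _] := (hahn_neq0P q).1 q0.
have gN := NP g (or_intror qg) i0.
(* Squares [j ^ 2] with [j != N] differ from [N ^ 2] by at least [2N - 1]; as the first coordinate
   of [g] is below [N] in absolute value, the shifted one is at least [N] in absolute value. *)
have sqg : (s * q) (a N + g) = q g.
  apply: lacunary_coefM => // j jN; apply/eqP; apply: contraT => qgj.
  have := NP _ (or_intror qgj) i0; rewrite !mxE eqxx.
  by move: jN gN; move: (g ord0 i0) => x; nia.
have pg : supp p (a N + g) by rewrite /supp /= -spq sqg.
(* The first coordinate is at least [N ^ 2 - N + 1 >= N], against the bound on [supp p]. *)
have := NP _ (or_introl pg) i0; rewrite !mxE eqxx.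
by move: gN; move: (g ord0 i0) => x; nia.
Qed.

Lemma powser_frac_dim1 : n = 1%N -> powser_frac k n = [set: hahn k (Zlex n)].
Proof.
move=> n1; apply/seteqP; split=> // s _.
have [s0|/hahn_neq0P[g sg gmin]] := eqVneq s 0.
  have [one sB _] := fractions_divring_closed powser_subring.
  by have := sB 1 1 one one; rewrite subrr s0 inE.
(* With a single coordinate, the least exponent [g] bounds all exponents from below, so shifting by
   its absolute value suffices. *)
rewrite -(divr1 s); apply: (@fractions_monomM _ (\row_i `|g ord0 i| : Zlex n)).
- exact: oner_neq0.
- rewrite powserE => h /supp_monom1M/gmin.
  rewrite le_eqVlt => /predU1P[gE i|/Zlex_ltP[j gj _] i].
    have := congr1 (fun u : Zlex n => u ord0 i) gE; rewrite !mxE.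
    by move: (g ord0 i) (h ord0 i) => x y; lia.
  have -> : i = j by apply: val_inj; move: (ltn_ord i) (ltn_ord j) => /=; lia.
  by move: gj; rewrite !mxE; move: (g ord0 j) (h ord0 j) => x y; lia.
- rewrite powserE mulr1 => h; rewrite /supp /=.
  by case: (h =P _) => [-> _ i|_]; rewrite ?eqxx // mxE.
Qed.

Lemma square_series_notin_powser_frac :
  (2 <= n)%N -> ~ powser_frac k n (square_series k n).
Proof.
move=> n2; pose i0 := Ordinal (ltnW n2); pose i1 := Ordinal n2.
rewrite /powser_frac powserE => -[p [q [pP qP q0 sE]]].
have spq : square_series k n * q = p by rewrite sE divfK.
pose P x := `[< exists2 g, q g != 0 & g ord0 i1 = x%:Z >].
have [|x /asboolP[g qg gx] xmin] := @ex_minnP P.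
  have [g qg _] := (hahn_neq0P q).1 q0; exists `|g ord0 i1|%N; apply/asboolP.
  by exists g; rewrite // gez0_abs //; exact: qP.
(* [N] exceeds the first coordinate of [g], to exclude [j > N], and exceeds [x], to make the second
   coordinate [x - N] of the final exponent negative. *)
pose N := (`|g ord0 i0| + x).+1.
have sqg : (square_series k n * q) (square_exp n N + g) = q g.
  apply: lacunary_coefM => // j jN; apply/eqP; apply: contraT => qgj.
  have h0 := qP _ qgj i0; have h1 := qP _ qgj i1.
  have /xmin : P `|(g + (square_exp n N - square_exp n j)%R)%R ord0 i1|%N.
    by apply/asboolP; eexists; [exact: qgj|rewrite gez0_abs].
  move: h0 h1; rewrite !mxE /= gx.
  by move: jN; rewrite /N; move: (g ord0 i0) => y; nia.
have pg : supp p (square_exp n N + g) by rewrite /supp /= -spq sqg.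
by have := pP _ pg i1; rewrite !mxE /= gx /N; lia.
Qed.

End PowerSeries.

Theorem mainTheorem4 (k : fieldType) (n : nat) (hn : (0 < n)%N) :
  [/\ (* (i) *)
      [/\ min_hahn k (Zlex n) = polynom_frac k n,
          polynom_frac k n `<=` powser_frac k n,
          powser_frac k n `<=` [set: hahn k (Zlex n)],
          hahn_field (polynom_frac k n) &
          hahn_field (powser_frac k n)],
      (* (ii) *)
      [/\ powser_frac k n =
            lrs_span (lrs_dom_in k [set A : set (Zlex n) | A `<=` orthant n]),
          powser_frac k n =
            lrs_span (lrs_dom_in k [set orthant n]) &
          lrs_determined (powser_frac k n)],
      (* (iii) *)
      powser_frac k n <> min_hahn k (Zlex n) /\
      powser_frac k n <> polynom_frac k n &
      (* (iv) *)
      (n = 1%N -> powser_frac k n = [set: hahn k (Zlex n)]) /\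
      ((2 <= n)%N ->
        powser_frac k n <> [set: hahn k (Zlex n)] /\
        ~ powser_frac k n (square_series k n))].
Proof.
have pfE := min_hahn_Zlex k n.
(* The three sets in (ii) are equal by a cycle of inclusions. *)
have lrs_sub : lrs_span (lrs_dom_in k [set A : set (Zlex n) | A `<=` orthant n])
    `<=` powser_frac k n.
  by move=> s [r [r0 rP]]; exact: lrs_solutions_powser_frac.
have lrs_orthant : lrs_span (lrs_dom_in k [set orthant n]) `<=`
    lrs_span (lrs_dom_in k [set A : set (Zlex n) | A `<=` orthant n]).
  move=> s [r [r0 rE] rs]; exists r => //; split => //.
  by rewrite /= (rE : pdom r = _).
have powser_lrs := @powser_frac_lrs k n.
have orthant_lrs : powser_frac k n = lrs_span (lrs_dom_in k [set orthant n]).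
  by apply/seteqP; split => // s /lrs_orthant/lrs_sub.
have neq := @powser_frac_neq_polynom_frac k n hn.
split.
- split => //.
  + exact: polynom_frac_powser_frac.
  + split; rewrite -pfE //.
    exact/fractions_divring_closed/group_algebra_subring.
  + split; first exact/fractions_divring_closed/powser_subring.
    by rewrite pfE; exact: polynom_frac_powser_frac.
- split => //; last by exists (lrs_dom_in k [set orthant n]).
  by apply/seteqP; split => // s /powser_lrs/lrs_orthant.
- by rewrite pfE.
- split; first exact: powser_frac_dim1.
  move=> n2; have nin := @square_series_notin_powser_frac k n n2.
  by split => // E; apply: nin; rewrite E.
Qed.
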